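(* Let $K$ be a field, $J$ an ideal in the polynomial ring $K[x]=K[x_1,\ldots,x_n]$, $R=K[x]/J$, and $F=\{f_1+J,\ldots,f_m+J\}\subseteq R$ a finite subset, with $f_i\in K[x]$. Let $S=[F]$ be the multiplicative submonoid of $R$ generated by $F$. Consider the following algorithm with input $F$ and $J$: (1) let $\psi:K[t_1,\ldots,t_m]\to K[x_1,\ldots,x_n]/J$ be the $K$-algebra homomorphism with $t_i\mapsto f_i+J$; (2) compute $H:=\ker(\psi)$; (3) compute the saturation $M:=H:\langle t_1\cdots t_m\rangle^\infty$; (4) return $1$ if $1\in M$, and return $0$ otherwise. This algorithm terminates and is correct, i.e. it returns $1$ if $0\in S$ and returns $0$ if $0\notin S$.
   Context: $[F]$ denotes the set of all finite products of elements of $F$, where the empty product is $1$. For an ideal $H$ of $K[t]=K[t_1,\ldots,t_m]$ and $g\in K[t]$, $H:\langle g\rangle^\infty=\{p\in K[t]\mid \exists\, N\ge 0:\ g^N p\in H\}$. Kernels of homomorphisms between finitely presented commutative $K$-algebras, saturations of polynomial ideals and ideal membership are computed by the standard (terminating) Gröbner basis algorithms. *)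

(* Defs.v *)
From HB Require Import structures.
From mathcomp Require Import all_boot all_order all_algebra.
From mathcomp Require Import generic_quotient ring_quotient.
From mathcomp Require Import mpoly.

Set Implicit Arguments.
Unset Strict Implicit.
Unset Printing Implicit Defensive.

Import GRing.Theory.
Local Open Scope ring_scope.
Local Open Scope quotient_scope.

(* Ideals of a commutative ring.  The library's [idealr] and [proper_ideal]
   exclude the unit ideal, which must be allowed here: J may be the whole
   polynomial ring, and then the quotient is the zero ring. *)

HB.mixin Record isAbsorbing (A : comNzRingType) (I : A -> bool) := {
  ideal_absorb : forall a, {in I, forall u, a * u \in I}
}.

#[short(type="ideal")]
HB.structure Definition Ideal (A : comNzRingType) :=
  {I of GRing.ZmodClosed A I & isAbsorbing A I}.

(* The quotient A / I of a commutative K-algebra.  Its additive group is the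
   library's {quot I}; the library puts a ring structure on {quot I} only for
   proper ideals, hence the new carrier name.  The algebra structure is given by
   a commutative, possibly zero, ring together with a K-module structure, since
   [comAlgType] only contains nonzero rings. *)

Section QuotientAlgebra.
Variables (K : comNzRingType) (A : comAlgType K) (I : ideal A).

Definition quot_alg : Type := Quotient.quot I.

HB.instance Definition _ := GRing.Zmodule.on quot_alg.

Definition quot_pi (x : A) : quot_alg := \pi_(Quotient.quot I) x.

Lemma quot_piP (r : quot_alg) : exists x, r = quot_pi x.
Proof. by exists (repr r); rewrite /quot_pi reprK. Qed.

Lemma quot_pi_eq x y : (quot_pi x = quot_pi y) <-> (x - y \in I).
Proof. by rewrite Quotient.idealrBE; split=> [h|/eqP //]; apply/eqP. Qed.

Lemma quot_pi_is_zmod_morphism : zmod_morphism quot_pi.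
Proof. by move=> x y; rewrite /quot_pi raddfB. Qed.

HB.instance Definition _ :=
  GRing.isZmodMorphism.Build A quot_alg quot_pi quot_pi_is_zmod_morphism.

Definition quot_one : quot_alg := quot_pi 1.
Definition quot_mul (r s : quot_alg) : quot_alg :=
  quot_pi (repr (r : Quotient.quot I) * repr (s : Quotient.quot I)).
Definition quot_scale (a : K) (r : quot_alg) : quot_alg :=
  quot_pi (a *: repr (r : Quotient.quot I)).

Lemma quot_repr x : repr (quot_pi x : Quotient.quot I) - x \in I.
Proof. by apply/quot_pi_eq; rewrite /quot_pi reprK. Qed.

Lemma quot_mulE x y : quot_mul (quot_pi x) (quot_pi y) = quot_pi (x * y).
Proof.
apply/quot_pi_eq; set x' := repr _; set y' := repr _.
have -> : x' * y' - x * y = y' * (x' - x) + x * (y' - y).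
  by rewrite !mulrBr addrA [y' * x']mulrC [y' * x]mulrC subrK.
by apply: rpredD; apply: ideal_absorb; apply: quot_repr.
Qed.

Lemma quot_scaleE a x : quot_scale a (quot_pi x) = quot_pi (a *: x).
Proof.
apply/quot_pi_eq; rewrite -scalerBr -mulr_algl.
by apply: ideal_absorb; apply: quot_repr.
Qed.

Lemma quot_mulA : associative quot_mul.
Proof.
move=> r s t; have [x ->] := quot_piP r; have [y ->] := quot_piP s.
by have [z ->] := quot_piP t; rewrite !quot_mulE mulrA.
Qed.

Lemma quot_mulC : commutative quot_mul.
Proof.
move=> r s; have [x ->] := quot_piP r; have [y ->] := quot_piP s.
by rewrite !quot_mulE mulrC.
Qed.

Lemma quot_mul1 : left_id quot_one quot_mul.
Proof. by move=> r; have [x ->] := quot_piP r; rewrite quot_mulE mul1r. Qed.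

Lemma quot_mulDl : left_distributive quot_mul +%R.
Proof.
move=> r s t; have [x ->] := quot_piP r; have [y ->] := quot_piP s.
by have [z ->] := quot_piP t; rewrite -raddfD !quot_mulE mulrDl raddfD.
Qed.

HB.instance Definition _ := GRing.Zmodule_isComPzRing.Build quot_alg
  quot_mulA quot_mulC quot_mul1 quot_mulDl.

Lemma quot_scaleA a b r : quot_scale a (quot_scale b r) = quot_scale (a * b) r.
Proof. by have [x ->] := quot_piP r; rewrite !quot_scaleE scalerA. Qed.

Lemma quot_scale1 : left_id 1 quot_scale.
Proof. by move=> r; have [x ->] := quot_piP r; rewrite quot_scaleE scale1r. Qed.

Lemma quot_scaleDr : right_distributive quot_scale +%R.
Proof.
move=> a r s; have [x ->] := quot_piP r; have [y ->] := quot_piP s.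
by rewrite -raddfD !quot_scaleE scalerDr raddfD.
Qed.

Lemma quot_scaleDl r : {morph quot_scale^~ r : a b / a + b}.
Proof.
by move=> a b; have [x ->] := quot_piP r; rewrite !quot_scaleE scalerDl raddfD.
Qed.

HB.instance Definition _ := GRing.Zmodule_isLmodule.Build K quot_alg
  quot_scaleA quot_scale1 quot_scaleDr quot_scaleDl.

Lemma quot_pi_is_monoid_morphism : monoid_morphism quot_pi.
Proof. by split=> // x y; rewrite -quot_mulE. Qed.

HB.instance Definition _ :=
  GRing.isMonoidMorphism.Build A quot_alg quot_pi quot_pi_is_monoid_morphism.

Lemma quot_pi_is_scalable : scalable quot_pi.
Proof. by move=> a x; rewrite -quot_scaleE. Qed.

HB.instance Definition _ :=
  GRing.isScalable.Build K A quot_alg *:%R quot_pi quot_pi_is_scalable.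

End QuotientAlgebra.

Section Presentation.
Variables (K : fieldType) (n m : nat) (J : ideal {mpoly K[n]}).
Variable f : m.-tuple {mpoly K[n]}.

(* The K-algebra homomorphism K[t_1..t_m] -> K[x]/J with t_i |-> f_i + J:
   substitute f_i for t_i, then reduce modulo J. *)
Definition presentation (p : {mpoly K[m]}) : quot_alg J := quot_pi J (p \mPo f).

HB.instance Definition _ :=
  GRing.LRMorphism.copy presentation (quot_pi J \o comp_mpoly f).

Lemma presentationX (i : 'I_m) : presentation 'X_i = quot_pi J (tnth f i).
Proof. by rewrite /presentation comp_mpolyXU -tnth_nth. Qed.

End Presentation.

(* The set [F] of all finite products of elements of F, the empty product
   being 1. *)
Definition products (R : pzSemiRingType) (F : R -> Prop) (r : R) : Prop :=
  exists2 s : seq R, (forall x, x \in s -> F x) & r = \prod_(x <- s) x.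

Definition ideal_span (A : comNzRingType) (gs : seq A) (p : A) : Prop :=
  exists c : 'I_(size gs) -> A, p = \sum_(i < size gs) c i * gs`_i.

Definition generates (A : comNzRingType) (gs : seq A) (I : A -> Prop) : Prop :=
  forall p, I p <-> ideal_span gs p.

Definition saturation (A : comNzRingType) (H : A -> Prop) (g p : A) : Prop :=
  exists N : nat, H (g ^+ N * p).

(* Possibly nonterminating computations (the delay monad): a computation either
   returns a value or performs one more step, and may perform steps forever, so
   that termination is a genuine property. *)
CoInductive computation (T : Type) : Type :=
  | Ret of T
  | Step of computation T.

Inductive returns (T : Type) : computation T -> T -> Prop :=
  | returns_Ret x : returns (Ret x) x
  | returns_Step c x : returns c x -> returns (Step c) x.

Definition terminates (T : Type) (c : computation T) : Prop :=
  exists x, returns c x.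

CoFixpoint bind (T U : Type) (c : computation T) (k : T -> computation U)
    : computation U :=
  match c with
  | Ret x => Step (k x)
  | Step c' => Step (bind c' k)
  end.

(* The Groebner basis subroutines are arbitrary procedures, specified below by
   termination and correctness on every input.  They exchange ideals as finite
   lists of generators, which every ideal of K[x_1..x_n] has. *)
Definition kernel_proc (K : fieldType) : Type := forall n m : nat,
  seq {mpoly K[n]} -> m.-tuple {mpoly K[n]} -> computation (seq {mpoly K[m]}).

Definition saturation_proc (K : fieldType) : Type := forall m : nat,
  seq {mpoly K[m]} -> {mpoly K[m]} -> computation (seq {mpoly K[m]}).

Definition membership_proc (K : fieldType) : Type := forall m : nat,
  seq {mpoly K[m]} -> {mpoly K[m]} -> computation bool.

Definition computes_kernels (K : fieldType) (ker : kernel_proc K) : Prop :=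
  forall (n m : nat) (J : ideal {mpoly K[n]}) (gs : seq {mpoly K[n]})
    (f : m.-tuple {mpoly K[n]}),
  generates gs (fun p => p \in J) ->
  exists2 hs, returns (ker n m gs f) hs &
    generates hs (fun p => presentation J f p = 0).

Definition computes_saturations (K : fieldType) (sat : saturation_proc K) :=
  forall (m : nat) (hs : seq {mpoly K[m]}) (g : {mpoly K[m]}),
  exists2 ms, returns (sat m hs g) ms &
    generates ms (saturation (ideal_span hs) g).

Definition decides_membership (K : fieldType) (memb : membership_proc K) :=
  forall (m : nat) (ms : seq {mpoly K[m]}) (p : {mpoly K[m]}),
  exists2 b, returns (memb m ms p) b & (b <-> ideal_span ms p).

(* The algorithm; J is input through the generators gs, and F through the
   representatives f. *)
Definition zero_test (K : fieldType) (ker : kernel_proc K)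
    (sat : saturation_proc K) (memb : membership_proc K) (n m : nat)
    (f : m.-tuple {mpoly K[n]}) (gs : seq {mpoly K[n]}) : computation nat :=
  bind (ker n m gs f) (fun H =>
  bind (sat m H (\prod_(i < m) 'X_i)) (fun M =>
  bind (memb m M 1) (fun b =>
  Ret (if b then 1%N else 0%N)))).

(* Main.v *)
Require Import Defs.
From HB Require Import structures.
From mathcomp Require Import all_boot all_order all_algebra.
From mathcomp Require Import mpoly.
Import GRing.Theory.
Local Open Scope ring_scope.

(** In a commutative ring, 0 is a product of the generators [a_1 .. a_m] exactly
    when the single element [P = a_1 ... a_m] is nilpotent.  Every power of [P]
    is such a product, and conversely every generator divides [P], so a product
    of [N] generators divides [P ^ N]; if the product is 0, so is the power
    ([zero_products]).

    For [a_i = f_i + J] the element [P] is the image of [t_1 ... t_m] under the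
    presentation map, so its nilpotency says that a power of [t_1 ... t_m] lies
    in the kernel [H], that is, that 1 lies in the saturation of [H]
    ([zero_productsE]).  This is the condition that the algorithm tests.
    It halts because it runs three halting subroutines in sequence, so its
    result can be read off by composing their results ([returns_bind]). *)

Lemma returns_bind (T U : Type) (c : computation T) (k : T -> computation U)
    (x : T) (y : U) :
  returns c x -> returns (k x) y -> returns (bind c k) y.
Proof.
(* [bind] is corecursive and unfolds only under a match, hence the detour
   through this propositional unfolding. *)
have bindE d : bind d k = match d with
    | Ret z => Step (k z)
    | Step d' => Step (bind d' k)
    end.
  have unfold e : e = match e with Ret z => Ret z | Step e' => @Step U e' end.
    by case: e.
  by rewrite [LHS]unfold; case: d.
by elim=> [z | d z _ IHd] ret_k; rewrite bindE; apply: returns_Step; auto.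
Qed.

Lemma products1 (R : pzSemiRingType) (F : R -> Prop) : products F 1.
Proof. by exists [::]; rewrite ?big_nil. Qed.

Lemma productsM (R : pzSemiRingType) (F : R -> Prop) (r s : R) :
  products F r -> products F s -> products F (r * s).
Proof.
move=> [u Fu ->] [v Fv ->]; exists (u ++ v); last by rewrite big_cat.
by move=> x; rewrite mem_cat => /orP[/Fu | /Fv].
Qed.

Lemma products_gen (R : pzSemiRingType) (F : R -> Prop) (r : R) :
  F r -> products F r.
Proof.
by move=> Fr; exists [:: r]; rewrite ?big_seq1 // => x; rewrite inE => /eqP->.
Qed.

Lemma productsX (R : pzSemiRingType) (F : R -> Prop) (r : R) (N : nat) :
  products F r -> products F (r ^+ N).
Proof.
move=> Fr; elim: N => [|N IHN]; first exact: products1.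
by rewrite exprS; apply: productsM.
Qed.

(** The exponent is the length of the product: each factor is completed to [P]
    by its own cofactor. *)
Lemma products_dvd_exp (R : comPzRingType) (F : R -> Prop) (P r : R) :
  (forall x, F x -> exists c, P = c * x) ->
  products F r -> exists N, exists c, P ^+ N = c * r.
Proof.
move=> F_dvd [s Fs ->]; exists (size s).
elim: s Fs => [|x s IHs] Fs; first by exists 1; rewrite big_nil mulr1.
have [|c Ec] := F_dvd x; first by apply: Fs; rewrite mem_head.
have [|d Ed] := IHs; first by move=> y sy; apply: Fs; rewrite inE sy orbT.
by exists (c * d); rewrite big_cons [size _]/= exprS Ed {1}Ec mulrACA.
Qed.

(** The many-generator question reduces to one element, whose powers are
    cofinal for divisibility among the products of generators. *)
Lemma zero_products (R : comPzRingType) (m : nat) (a : 'I_m -> R) :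
  products (fun r => exists i, r = a i) 0 <->
  exists N, (\prod_(i < m) a i) ^+ N = 0.
Proof.
split=> [S0 | [N PN0]].
  have [|N [c PN]] := @products_dvd_exp R _ (\prod_(i < m) a i) 0 _ S0.
    move=> _ [i ->]; exists (\prod_(j < m | j != i) a j).
    by rewrite (bigD1 i) //= mulrC.
  by exists N; rewrite PN mulr0.
rewrite -PN0; apply: productsX; elim/big_ind: _ => [|r s|i _].
- exact: products1.
- exact: productsM.
- by apply: products_gen; exists i.
Qed.

(** The presentation map is multiplicative and sends [t_1 ... t_m] to the
    product of all generators, so nilpotency of the latter is a statement about
    powers of [t_1 ... t_m] in the kernel. *)
Lemma zero_productsE (K : fieldType) (n m : nat) (J : ideal {mpoly K[n]})
    (f : m.-tuple {mpoly K[n]}) :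
  products (fun r => exists i : 'I_m, r = quot_pi J (tnth f i)) 0 <->
  saturation (fun p => presentation J f p = 0) (\prod_(i < m) 'X_i) 1.
Proof.
have presentationT N : presentation J f ((\prod_(i < m) 'X_i) ^+ N * 1) =
    (\prod_(i < m) quot_pi J (tnth f i)) ^+ N.
  rewrite mulr1 rmorphXn rmorph_prod; congr (_ ^+ N).
  by apply: eq_bigr => i _; apply: presentationX.
rewrite zero_products /saturation.
by split=> -[N E0]; exists N; rewrite -E0 presentationT.
Qed.

Theorem proposition12 (K : fieldType)
  (ker : kernel_proc K) (hker : computes_kernels ker)
  (sat : saturation_proc K) (hsat : computes_saturations sat)
  (memb : membership_proc K) (hmemb : decides_membership memb)
  (n m : nat)
  (J : ideal {mpoly K[n]}) (gs : seq {mpoly K[n]})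
  (hgs : generates gs (fun p => p \in J))
  (f : m.-tuple {mpoly K[n]}) :
  let R := quot_alg J in
  let F := fun r : R => exists i : 'I_m, r = quot_pi J (tnth f i) in
  let S := products F in
  let A := zero_test ker sat memb f gs in
  terminates A /\ (S 0 -> returns A 1%N) /\ (~ S 0 -> returns A 0%N).
Proof.
move=> R F S A.
have [H retH genH] := hker n m J gs f hgs.
have [M retM genM] := hsat m H (\prod_(i < m) 'X_i).
have [b retb bP] := hmemb m M 1.
have retA : returns A (if b then 1%N else 0%N).
  apply: returns_bind retH _; apply: returns_bind retM _.
  by apply: returns_bind retb _; apply: returns_Ret.
have bS : b <-> S 0.
  rewrite bP -genM /S zero_productsE /saturation.
  by split=> -[N HN]; exists N; apply/genH.
split; first by exists (if b then 1%N else 0%N).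
case: b {bP retb} bS retA => bS retA; split=> // S0.
- by case: S0; apply/bS.
- by move/bS: S0.
Qed.
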